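(* Let $f:\mathbb{R}^n\to\mathbb{R}$ be locally Lipschitz and weakly upper semismooth, let $\bm x_0\in\mathbb{R}^n$, and suppose that the sublevel set $\{\bm x\in\mathbb{R}^n : f(\bm x)\le f(\bm x_0)\}$ is bounded. Let $\{\delta_\nu\}\downarrow 0$ and $\{\varepsilon_\nu\}\downarrow 0$ be positive sequences with $\varepsilon_\nu\in(0,1)$ for all $\nu$. If Algorithm C (defined in the context) is run from $\bm x_0$ with these sequences and optimality tolerance $\eta=0$, then any accumulation point $\bm x^*$ of the sequence $\{\bm x_\nu\}_\nu$ it generates is Clarke stationary for $f$, i.e. $\bm 0\in\partial f(\bm x^* )$.
   Context: Notation: $\|\cdot\|$ is the Euclidean norm, $\mathcal B(\bm x,\varepsilon)$ is the open ball with center $\bm x$ and radius $\varepsilon$, $\mathrm{conv}$ is the convex hull. $\partial f(\bm x)$ is the Clarke subdifferential: the convex hull of all limits $\lim_i\nabla f(\bm x_i)$ with $\bm x_i\to\bm x$ and $f$ differentiable at each $\bm x_i$. For $\varepsilon>0$ the Goldstein $\varepsilon$-subdifferential $\partial_\varepsilon f(\bm x)$ is the closed convex hull of $\bigcup_{\bm y\in\mathcal B(\bm x,\varepsilon)}\partial f(\bm y)$. Weakly upper semismooth: for any $\bm z,\bm d\in\mathbb{R}^n$ and any sequences $\{\boldsymbol\xi_i\}_i\subset\mathbb{R}^n$, $\{h_i\}_i\subset(0,\infty)$ with $h_i\downarrow0$ and $\boldsymbol\xi_i\in\partial f(\bm z+h_i\bm d)$, one has $\limsup_{i\to\infty}\boldsymbol\xi_i^T\bm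 d\ge\liminf_{i\to\infty}\frac{f(\bm z+h_i\bm d)-f(\bm z)}{h_i}$. Algorithm A (two-point line search). Inputs: $\varepsilon\in(0,1)$, a point $\bm x\in\mathbb{R}^n$, and a direction $\bm d=-\bm g^*/\|\bm g^*\|$ with $\bm g^*\in\mathbb{R}^n\setminus\{\bm 0\}$. Parameters: $\beta_1,\beta_2\in(0,1)$ with $\beta_1<\beta_2$, $\zeta\in(0,0.5)$, $\bar t\in(0,\varepsilon)$, $p\in\mathbb{N}$. Output: $\bm s\in\mathbb{R}^n$ and an indicator $\mathrm I\in\{0,1\}$. Initialization: choose any $t_0\in(\bar t,\varepsilon)$, set $\bar t_0:=1$, compute any $\boldsymbol\xi_0\in\partial f(\bm x+t_0\bm d)$, set $t_0^l:=0$, $t_0^u:=\varepsilon$, $i:=0$. Iteration $i$ consists of the following steps in order: (1) if $f(\bm x+t_i\bm d)-f(\bm x)\le-\beta_1t_i\|\bm g^*\|$, set $t_{i+1}^l:=t_i$, $t_{i+1}^u:=t_i^u$; else set $t_{i+1}^l:=t_i^l$, $t_{i+1}^u:=t_i$. (2) If $f(\bm x+\bar t_i\bm d)-f(\bm x)\le-\beta_1\bar t_i\|\bm g^*\|$ and $\bar t_i\ge\bar t$, return $\mathrm I:=1$, $\bm s:=\bm x+\bar t_i\bm d$ and stop. (3) If $\boldsymbol\xi_i^T\bm d\ge-\beta_2\|\bm g^*\|$, return $\mathrm I:=0$, $\bm s:=\boldsymbol\xi_i$ and stop. (4) Choose any $t_{i+1}\in[t_{i+1}^l+\zeta(t_{i+1}^u-t_{i+1}^l),\,t_{i+1}^u-\zeta(t_{i+1}^u-t_{i+1}^l)]$,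 set $\bar t_{i+1}:=\left(\exp\left(\frac{\log t_0}{p}\right)\right)^{i+1}$, compute any $\boldsymbol\xi_{i+1}\in\partial f(\bm x+t_{i+1}\bm d)$, set $i:=i+1$, and repeat. Algorithm B. Inputs: starting point $\bm y_0\in\mathbb{R}^n$, $\varepsilon\in(0,1)$, $\delta>0$; the parameters $\beta_1,\beta_2,\zeta,\bar t,p$ of Algorithm A are fixed throughout a run (with $\bar t\in(0,\varepsilon)$). Compute any $\boldsymbol\xi_0\in\partial f(\bm y_0)$, set $\mathcal G_\varepsilon(\bm y_0):=\{\boldsymbol\xi_0\}$, $k:=0$. Iteration $k$: let $\bm g_k^*$ be the minimum-norm element of $\mathrm{conv}\,\mathcal G_\varepsilon(\bm y_k)$. If $\|\bm g_k^*\|\le\delta$, return $\bm y_k$ and stop. Otherwise set $\bm d_k:=-\bm g_k^*/\|\bm g_k^*\|$ and let $(\bm s_k,\mathrm I_k)$ be the output of Algorithm A with inputs $\varepsilon,\bm y_k,\bm d_k$ (and $\bm g^*=\bm g_k^*$). If $\mathrm I_k=1$, set $\bm y_{k+1}:=\bm s_k$, compute any $\boldsymbol\xi_{k+1}\in\partial f(\bm y_{k+1})$, and set $\mathcal G_\varepsilon(\bm y_{k+1}):=\{\boldsymbol\xi_{k+1}\}$. If $\mathrm I_k=0$, set $\bm y_{k+1}:=\bm y_k$, $\boldsymbol\xi_{k+1}:=\bm s_k$ and $\mathcal G_\varepsilon(\bm y_{k+1}):=\mathcal G_\varepsilon(\bm y_k)\cup\{\boldsymbol\xi_{k+1}\}$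 (the working set is indexed by the iteration $k$). Set $k:=k+1$ and repeat. Algorithm C. Inputs: $\bm x_0\in\mathbb{R}^n$, positive sequences $\{\delta_\nu\}\downarrow0$, $\{\varepsilon_\nu\}\downarrow0$, and a tolerance $\eta\ge 0$. For $\nu=0,1,2,\dots$: let $\bm x_{\nu+1}$ be the point returned by Algorithm B with starting point $\bm x_\nu$, radius $\varepsilon_\nu$ and tolerance $\delta_\nu$ (with lower bound $\bar t\in(0,\varepsilon_\nu)$ for this call); if $\delta_\nu\le\eta$ and $\varepsilon_\nu\le\eta$, stop. With $\eta=0$ the algorithm never stops and generates an infinite sequence $\{\bm x_\nu\}_\nu$. *)

(* Defs.v *)
From HB Require Import structures.
From mathcomp Require Import all_boot all_order all_algebra.
From mathcomp Require Import all_classical all_reals all_analysis.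

Set Implicit Arguments.
Unset Strict Implicit.
Unset Printing Implicit Defensive.

Import Order.TTheory GRing.Theory Num.Theory.
Import numFieldNormedType.Exports.

Local Open Scope classical_set_scope.
Local Open Scope ring_scope.

Section Nonsmooth.
Context (R : realType) (n : nat).
Implicit Types (f : 'rV[R]_n -> R) (A : set 'rV[R]_n) (u v x : 'rV[R]_n).

Definition dotp u v : R := \sum_(i < n) u ord0 i * v ord0 i.

(* The library norm `|u| on row vectors is the sup norm.  It induces the same
   topology, so limits, neighborhoods, differentiability and boundedness are
   taken from the library. *)
Definition enorm u : R := Num.sqrt (dotp u u).

Definition conv A : set 'rV[R]_n :=
  [set v | exists m (c : 'I_m -> R) (a : 'I_m -> 'rV[R]_n),
    [/\ forall i, 0 <= c i, \sum_i c i = 1, forall i, A (a i)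
      & v = \sum_i c i *: a i]].

Definition grad f x : 'rV[R]_n := \row_(i < n) 'D_(delta_mx ord0 i) f x.

Definition clarke f x : set 'rV[R]_n :=
  conv [set g | exists u : nat -> 'rV[R]_n,
    [/\ forall i, differentiable f (u i), u i @[i --> \oo] --> x
      & grad f (u i) @[i --> \oo] --> g]].

Definition locally_lipschitz f : Prop :=
  forall x, exists L : R, exists2 U, nbhs x U &
    forall y z, U y -> U z -> `|f y - f z| <= L * enorm (y - z).

Definition decreases_to0 (h : nat -> R) : Prop :=
  [/\ forall i, 0 < h i, nonincreasing_seq h & h i @[i --> \oo] --> (0 : R)].

Definition weakly_upper_semismooth f : Prop :=
  forall (z d : 'rV[R]_n) (xi : nat -> 'rV[R]_n) (h : nat -> R),
    decreases_to0 h ->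
    (forall i, clarke f (z + h i *: d) (xi i)) ->
    (limn_einf (fun i => ((f (z + h i *: d) - f z) / h i)%:E)
       <= limn_esup (fun i => (dotp (xi i) d)%:E))%E.

End Nonsmooth.

Section LineSearch.
Context (R : realType) (n : nat) (f : 'rV[R]_n -> R).
Context (beta1 beta2 zeta : R) (p : nat).
Implicit Types (x y s g xi : 'rV[R]_n) (eps tbar delta : R).

Definition descent_dir g : 'rV[R]_n := - ((enorm g)^-1 *: g).

Definition sufficient_decrease x g (t : R) : bool :=
  f (x + t *: descent_dir g) - f x <= - beta1 * t * enorm g.

(* The second trial step of iteration i; it is 1 for i = 0. *)
Definition trial_step (t0 : R) (i : nat) : R := expR (ln t0 / p%:R) ^+ i.

Definition descent_stop tbar x g (t0 : R) (i : nat) : bool :=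
  sufficient_decrease x g (trial_step t0 i) && (tbar <= trial_step t0 i).

Definition subgradient_stop g xi : bool :=
  - beta2 * enorm g <= dotp xi (descent_dir g).

(* [ls_iter eps tbar x g t0 i t xi tl tu]: some execution of the line search
   with first step t0 enters iteration i with t_i = t, xi_i = xi and bracket
   [t_i^l, t_i^u] = [tl, tu].  The free choices of steps and subgradients make
   the algorithm a relation. *)
Inductive ls_iter eps tbar x g (t0 : R) :
    nat -> R -> 'rV[R]_n -> R -> R -> Prop :=
| ls_init xi0 :
    tbar < t0 < eps ->
    clarke f (x + t0 *: descent_dir g) xi0 ->
    ls_iter eps tbar x g t0 0 t0 xi0 0 eps
| ls_next i t xi tl tu tl' tu' t' xi' :
    ls_iter eps tbar x g t0 i t xi tl tu ->
    tl' = (if sufficient_decrease x g t then t else tl) ->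
    tu' = (if sufficient_decrease x g t then tu else t) ->
    ~~ descent_stop tbar x g t0 i ->
    ~~ subgradient_stop g xi ->
    tl' + zeta * (tu' - tl') <= t' <= tu' - zeta * (tu' - tl') ->
    clarke f (x + t' *: descent_dir g) xi' ->
    ls_iter eps tbar x g t0 i.+1 t' xi' tl' tu'.

(* The boolean is the indicator I of the output. *)
Inductive ls_returns eps tbar x g : 'rV[R]_n -> bool -> Prop :=
| ls_returns_point t0 i t xi tl tu :
    ls_iter eps tbar x g t0 i t xi tl tu ->
    descent_stop tbar x g t0 i ->
    ls_returns eps tbar x g (x + trial_step t0 i *: descent_dir g) true
| ls_returns_subgradient t0 i t xi tl tu :
    ls_iter eps tbar x g t0 i t xi tl tu ->
    ~~ descent_stop tbar x g t0 i ->
    subgradient_stop g xi ->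
    ls_returns eps tbar x g xi false.

Definition min_norm_element (A : set 'rV[R]_n) g : Prop :=
  A g /\ forall v, A v -> enorm g <= enorm v.

(* [descent_iter eps tbar delta y0 y G]: some execution started at y0 enters
   an iteration with current point y and working set G. *)
Inductive descent_iter eps tbar delta y0 :
    'rV[R]_n -> set 'rV[R]_n -> Prop :=
| descent_init xi0 :
    clarke f y0 xi0 ->
    descent_iter eps tbar delta y0 y0 [set xi0]
| descent_serious y G g s xi :
    descent_iter eps tbar delta y0 y G ->
    min_norm_element (conv G) g ->
    delta < enorm g ->
    ls_returns eps tbar y g s true ->
    clarke f s xi ->
    descent_iter eps tbar delta y0 s [set xi]
| descent_null y G g s :
    descent_iter eps tbar delta y0 y G ->
    min_norm_element (conv G) g ->
    delta < enorm g ->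
    ls_returns eps tbar y g s false ->
    descent_iter eps tbar delta y0 y (G `|` [set s]).

Inductive descent_returns eps tbar delta y0 : 'rV[R]_n -> Prop :=
| descent_return y G g :
    descent_iter eps tbar delta y0 y G ->
    min_norm_element (conv G) g ->
    enorm g <= delta ->
    descent_returns eps tbar delta y0 y.

(* The sequence x is generated from x0 with tolerance eta.  The point x nu.+1
   is computed only if the run has not stopped at an earlier index; entries of
   x after the stop are unconstrained.  If delta and eps are positive and
   eta = 0, then no index stops and all of x is generated. *)
Definition outer_run (eps tbar delta : nat -> R) (eta : R) (x0 : 'rV[R]_n)
    (x : nat -> 'rV[R]_n) : Prop :=
  x 0%N = x0 /\
  forall nu,
    (forall mu, (mu < nu)%N -> ~~ ((delta mu <= eta) && (eps mu <= eta))) ->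
    descent_returns (eps nu) (tbar nu) (delta nu) (x nu) (x nu.+1).

End LineSearch.

(* Main.v *)
(* A terminating call of Algorithm B returns y together with an element of norm
   at most delta in the convex hull of subgradients taken within distance eps
   of y, since the brackets of Algorithm A stay inside [0, eps].  Along indices
   nu for which x (nu + 1) is close to xstar, these elements tend to 0, and the
   closed graph and convexity of the Clarke subdifferential give the claim. *)
Require Import Defs.
From HB Require Import structures.
From mathcomp Require Import all_boot all_order all_algebra.
From mathcomp Require Import all_classical all_reals all_analysis.
From mathcomp Require Import ring lra.

Set Implicit Arguments.
Unset Strict Implicit.
Unset Printing Implicit Defensive.

Import Order.TTheory GRing.Theory Num.Theory.
Import numFieldNormedType.Exports.

Local Open Scope classical_set_scope.
Local Open Scope ring_scope.

(** * Convex hulls in finite dimension, up to Caratheodory's theorem *)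

Section Convex_hull.
Context (R : realType) (n : nat).
Implicit Types (A B : set 'rV[R]_n) (v : 'rV[R]_n).

Lemma conv_finType A (I : finType) (c : I -> R) (a : I -> 'rV[R]_n) :
  (forall i, 0 <= c i) -> \sum_i c i = 1 -> (forall i, A (a i)) ->
  Defs.conv A (\sum_i c i *: a i).
Proof.
move=> c0 c1 Aa; exists #|I|, (c \o enum_val), (a \o enum_val).
split => [i||i|] //=; first by rewrite -(big_enum_val c).
by rewrite -(big_enum_val (fun i => c i *: a i)).
Qed.

Lemma conv_mono A B : A `<=` B -> Defs.conv A `<=` Defs.conv B.
Proof.
move=> AB v [m [c [a [c0 c1 Aa ->]]]].
by exists m, c, a; split => // i; exact: AB.
Qed.

(** Nested combinations flatten over the dependent sum of their index sets, with products of
    weights. *)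
Lemma conv_idem A : Defs.conv (Defs.conv A) `<=` Defs.conv A.
Proof.
move=> v [m [c [a [c0 c1 conv_a ->]]]].
have [k {}conv_a] := all_sig (fun i => cid (conv_a i)).
have [d {}conv_a] := all_sig (fun i => cid (conv_a i)).
have [b Ab] := all_sig (fun i => cid (conv_a i)).
have -> : \sum_i c i *: a i =
    \sum_(q : {i : 'I_m & 'I_(k i)}) (c (tag q) * d (tag q) (tagged q)) *:
      b (tag q) (tagged q).
  under eq_bigr => i _.
    have [_ _ _ ->] := Ab i; rewrite scaler_sumr.
    under eq_bigr do rewrite scalerA.
    over.
  by rewrite sig_big_dep.
apply: conv_finType => [[i j]||[i j]] /=.
- by have [d0 _ _ _] := Ab i; rewrite mulr_ge0.
- rewrite -[RHS]c1; under [RHS]eq_bigr => i _.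
    have [_ d1 _ _] := Ab i; rewrite -[c i]mulr1 -d1 mulr_sumr.
    over.
  by rewrite sig_big_dep.
- by have [_ _ + _] := Ab i; exact.
Qed.

(** The [m] points, each extended by a coordinate 1, are the rows of a matrix with [n.+1 < m]
    columns, so some nonzero [w] satisfies [w *m M = 0]. *)
Lemma affine_dependence m (a : 'I_m -> 'rV[R]_n) : (n.+1 < m)%N ->
  exists u : 'I_m -> R, [/\ exists i, 0 < u i, \sum_i u i = 0
    & \sum_i u i *: a i = 0].
Proof.
move=> nm; pose M := row_mx (\matrix_i a i) (const_mx 1 : 'cV[R]_m).
have : kermx M != 0.
  rewrite kermx_eq0 /row_free neq_ltn.
  by rewrite (leq_ltn_trans (rank_leq_col M)) ?addn1.
case/rowV0Pn => w /sub_kermxP; rewrite /M mul_mx_row => wM.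
have [wa w1] := eq_row_mx (etrans wM (esym (row_mx0 _ _ _ _))).
have sum_w0 : \sum_i w 0 i = 0.
  have := congr1 (fun A : 'M[R]_1 => A 0 0) w1; rewrite !mxE => w1'.
  by rewrite -[RHS]w1'; apply: eq_bigr => i _; rewrite mxE mulr1.
move=> w0; exists (w 0); split => //.
(* Without a positive entry, a zero sum of nonpositive terms would force [w = 0]. *)
- apply: contrapT => /forallNP w_le0; case/eqP: w0; apply/rowP => i.
  have Nw_ge0 j : true -> 0 <= - w 0 j.
    by move=> _; rewrite oppr_ge0 leNgt; exact/negP.
  have Nsum_w0 : \sum_i - w 0 i = 0 by rewrite sumrN sum_w0 oppr0.
  by rewrite mxE; apply/oppr_inj; rewrite (psumr_eq0P Nw_ge0 Nsum_w0) ?oppr0.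
- by rewrite -[RHS]wa mulmx_sum_row; apply: eq_bigr => i _; rewrite rowK.
Qed.

(** Moving the weights along an affine dependence [u] changes neither their sum nor the combination.
    Stopping at the smallest ratio [c i / u i] with [u i > 0] keeps all weights nonnegative and
    makes the [i]-th one vanish. *)
Lemma conv_drop m (c : 'I_m.+1 -> R) (a : 'I_m.+1 -> 'rV[R]_n) :
  (n.+1 < m.+1)%N ->
  (forall i, 0 <= c i) -> \sum_i c i = 1 ->
  exists (c' : 'I_m -> R) (s : 'I_m -> 'I_m.+1),
    [/\ forall i, 0 <= c' i, \sum_i c' i = 1
      & \sum_i c' i *: a (s i) = \sum_i c i *: a i].
Proof.
move=> nm c0 c1; have [u [[i0 ui0] u0 ua0]] := affine_dependence a nm.
have [i ui tmin] :=
  @arg_minP _ _ _ i0 (fun i => 0 < u i) (fun i => c i / u i) ui0.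
pose t := c i / u i.
have ti : c i - t * u i = 0 by rewrite /t divfK ?subrr // gt_eqF.
exists (fun j => c (lift i j) - t * u (lift i j)), (lift i); split.
- move=> j; rewrite subr_ge0.
  have [uj|uj] := ltP 0 (u (lift i j)); first by rewrite -ler_pdivlMr ?tmin.
  by apply: le_trans (c0 _); rewrite mulr_ge0_le0 // divr_ge0 // ltW.
- have : \sum_j (c j - t * u j) = 1.
    by rewrite big_split /= sumrN -mulr_sumr u0 mulr0 subr0.
  by rewrite (bigD1_ord i) //= ti add0r.
- have : \sum_j (c j - t * u j) *: a j = \sum_i c i *: a i.
    under eq_bigr do rewrite scalerBl -scalerA.
    by rewrite big_split /= sumrN -scaler_sumr ua0 scaler0 subr0.
  by rewrite (bigD1_ord i) //= ti scale0r add0r.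
Qed.

Lemma caratheodory A v : Defs.conv A v ->
  exists (c : 'I_n.+1 -> R) (a : 'I_n.+1 -> 'rV[R]_n),
    [/\ forall i, 0 <= c i, \sum_i c i = 1, forall i, A (a i)
      & v = \sum_i c i *: a i].
Proof.
move=> [m [c [a [c0 c1 Aa ->]]]]; elim: m => [|m IHm] in c a c0 c1 Aa *.
  by move: c1; rewrite big_ord0 => /esym/eqP; rewrite oner_eq0.
have [nm|mn] := ltnP n.+1 m.+1.
  have [c' [s [c'0 c'1 <-]]] := conv_drop a nm c0 c1.
  exact: (IHm c' (a \o s) c'0 c'1 (fun i => Aa (s i))).
(* Shorter combinations are padded with zero weights to exactly [n.+1] terms. Past [m], [inord]
   falls back on index 0, so the padding points still lie in [A]. *)
have ext (V : nmodType) (F : 'I_m.+1 -> V) :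
    \sum_(i < n.+1) (if (i <= m)%N then F (inord i) else 0) = \sum_j F j.
  by rewrite [RHS](big_ord_widen_leq n.+1) //= [RHS]big_mkcond.
exists (fun i => if (i <= m)%N then c (inord i) else 0), (a \o inord).
split => /=.
- by move=> i; case: ifP.
- by rewrite (ext _ c).
- by move=> i; exact: Aa.
- rewrite -(ext _ (fun j => c j *: a j)); apply: eq_bigr => i _.
  by case: ifP => //; rewrite scale0r.
Qed.

End Convex_hull.

(** * Limits along ultrafilters and compactness of closed balls *)

Section Ultrafilter_limits.

Lemma fmap_ultra (T U : Type) (f : T -> U) (F : set_system T) :
  UltraFilter F -> UltraFilter (f @ F).
Proof.
move=> FU; split=> [|G GP FG]; first exact: fmap_proper_filter.
rewrite eqEsubset; split=> // A GA.
have [//|FnA] := in_ultra_setVsetC (f @^-1` A) FU.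
have /filterI/(_ GA) : G (~` A) by exact: FG.
by rewrite setICl => /filter_not_empty.
Qed.

(** Replaces the extraction of subsequences: finitely many bounded families converge along the same
    ultrafilter. *)
Lemma compact_ultra_cvg (T : topologicalType) (I : Type) (F : set_system I)
    (A : set T) (u : I -> T) :
  UltraFilter F -> compact A -> (\forall i \near F, A (u i)) ->
  exists2 l, A l & u i @[i --> F] --> l.
Proof.
move=> FU + FA; rewrite compact_ultra => /(_ _ (fmap_ultra u FU) FA)[l [Al ul]].
by exists l.
Qed.

Lemma rV_norm_le (R : realType) n (v : 'rV[R]_n) (C : R) : 0 <= C ->
  (`|v| <= C) = [forall i, `|v ord0 i| <= C].
Proof.
move=> C0; rewrite (_ : `|v| = mx_norm v)// mx_normrE.
apply/bigmax_leP/forallP => /=.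
  by move=> [_ vC] i; exact: (vC (ord0, i)).
by move=> vC; split=> // -[i j] _ /=; rewrite ord1.
Qed.

Lemma rV_ball_compact (R : realType) n (C : R) :
  compact [set v : 'rV[R]_n | `|v| <= C].
Proof.
have [C0|C0] := leP 0 C; last first.
  rewrite (_ : mkset _ = set0); first exact: compact0.
  by apply/seteqP; split=> // v /= /le_lt_trans/(_ C0); rewrite normr_lt0.
rewrite (_ : mkset _ =
    [set v : 'rV[R]_n | forall i, `[-C, C]%classic (v ord0 i)]).
  apply: (@rV_compact R n (fun=> `[-C, C]%classic)) => _.
  exact: segment_compact.
apply/seteqP; split=> v /=; rewrite rV_norm_le//.
  by move=> /forallP vC i; rewrite in_itv/= -ler_norml.
by move=> vC; apply/forallP => i; have := vC i; rewrite in_itv/= -ler_norml.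
Qed.

End Ultrafilter_limits.

(** * Local boundedness of gradients and closedness of the Clarke subdifferential *)

Section Clarke.
Context (R : realType) (n : nat).
Implicit Types (f : 'rV[R]_n -> R) (x g v : 'rV[R]_n).

Lemma norm_le_enorm v : `|v| <= enorm v.
Proof.
rewrite rV_norm_le ?sqrtr_ge0//; apply/forallP => i.
rewrite -sqrtr_sqr ler_wsqrtr// /dotp (bigD1 i)//= -expr2 lerDl.
by apply: sumr_ge0 => j _; rewrite -expr2 sqr_ge0.
Qed.

Definition limiting_gradient f x : set 'rV[R]_n :=
  [set g | exists u : nat -> 'rV[R]_n,
    [/\ forall i, differentiable f (u i), u i @[i --> \oo] --> x
      & grad f (u i) @[i --> \oo] --> g]].

(** Trades sequences for single approximating points; conversely, points chosen at precision
    [i.+1%:R^-1] form the sequence. *)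
Lemma limiting_gradientP f x g : limiting_gradient f x g <->
  forall r, 0 < r -> exists u,
    [/\ differentiable f u, `|x - u| < r & `|g - grad f u| < r].
Proof.
split=> [[u [fu ux gu]] r r0|near_g].
  near \oo => i; exists (u i); split => //; near: i.
  - by move/cvgrPdist_lt : ux; exact.
  - by move/cvgrPdist_lt : gu; exact.
have /choice[u near_u] i : exists u, [/\ differentiable f u,
    `|x - u| < i.+1%:R^-1 & `|g - grad f u| < i.+1%:R^-1].
  by apply: near_g; rewrite invr_gt0.
exists u; split; first by move=> i; case: (near_u i).
- apply/cvgrPdist_lt => e e0; near=> i.
  have [_ /lt_trans + _] := near_u i; apply; near: i.
  exact: (near_infty_natSinv_lt (PosNum e0)).
- apply/cvgrPdist_lt => e e0; near=> i.
  have [_ _ /lt_trans] := near_u i; apply; near: i.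
  exact: (near_infty_natSinv_lt (PosNum e0)).
Unshelve. all: by end_near. Qed.

Lemma grad_bounded f x : locally_lipschitz f ->
  exists C r : R, [/\ 0 <= C, 0 < r & forall u, `|x - u| < r ->
    differentiable f u -> `|grad f u| <= C].
Proof.
move=> /(_ x)[L [U Ux f_lip]].
(* The constant [L] may be negative, hence [|L|]. The sum bounds the Euclidean norm of every basis
   vector at once. *)
pose C : R := `|L| * \sum_(i < n) enorm (delta_mx ord0 i : 'rV[R]_n).
have C0 : 0 <= C by rewrite mulr_ge0// sumr_ge0// => i _; exact: sqrtr_ge0.
have [r r0 rU] := (nbhs_ballP _ _).1 (nbhs_interior Ux).
exists C, r; split=> // u xu fu; rewrite rV_norm_le//; apply/forallP => i.
rewrite mxE; set e := delta_mx _ _.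
have Uu : nbhs u U by apply: rU; rewrite -ball_normE.
have enormZ (h : R) (v : 'rV[R]_n) : enorm (h *: v) = `|h| * enorm v.
  rewrite /enorm /dotp -sqrtr_sqr -sqrtrM ?sqr_ge0// mulr_sumr.
  by congr Num.sqrt; apply: eq_bigr => j _; rewrite !mxE; ring.
have Uhe : \forall h \near (0 : R)^', U (h *: e + u).
  apply: nbhs_dnbhs.
  have : h *: e + u @[h --> (0 : R)] --> (0 : R) *: e + u.
    by apply: cvgD; [apply: cvgZr_tmp; exact: cvg_id|exact: cvg_cst].
  by rewrite scale0r add0r; apply.
(* A partial derivative is a limit of difference quotients, each bounded by [C]. *)
apply: (cvgr_to_le (F := (0 : R)^')
    (f := fun h => `|h^-1 *: (f (h *: e + u) - f u)|)).
  by apply: cvg_norm; exact: diff_derivable.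
near=> h.
have h0 : h != 0 by near: h; exact: nbhs_dnbhs_neq.
rewrite normrZ normfV ler_pdivrMl ?normr_gt0//.
have Uh : U (h *: e + u) by near: h.
apply: le_trans (f_lip _ _ Uh (nbhs_singleton Uu)) _.
rewrite addrK enormZ mulrCA ler_wpM2l//.
apply: le_trans (ler_wpM2r (sqrtr_ge0 _) (ler_norm L)) _.
rewrite ler_wpM2l// (bigD1 i)//= lerDl.
by apply: sumr_ge0 => j _; exact: sqrtr_ge0.
Unshelve. all: by end_near. Qed.

(* Caratheodory's theorem bounds the number of points in the convex
   combinations approximating g, so all weights and points converge along one
   ultrafilter. *)
Lemma clarke_closed f x g : locally_lipschitz f ->
  (forall r, 0 < r -> exists2 v,
    Defs.conv [set w | exists2 z, `|x - z| < r & clarke f z w] v &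
    `|g - v| < r) ->
  clarke f x g.
Proof.
move=> /(grad_bounded x)[C [r [C0 r0 gradC]]] near_g.
(* At precision [k.+1%:R^-1], the nested hulls collapse to one hull of limiting gradients, which
   Caratheodory's theorem cuts down to [n.+1] points. *)
have /choice[c /choice[a ca]] (k : nat) : exists (c : 'I_n.+1 -> R)
    (a : 'I_n.+1 -> 'rV[R]_n),
    [/\ forall i, 0 <= c i, \sum_i c i = 1,
      forall i, exists2 z, `|x - z| < k.+1%:R^-1 & limiting_gradient f z (a i)
      & `|g - \sum_i c i *: a i| < k.+1%:R^-1].
  have [|v conv_v gv] := near_g k.+1%:R^-1; first by rewrite invr_gt0.
  have /caratheodory[c [a [c0 c1 Ta vE]]] : Defs.conv
      [set w | exists2 z, `|x - z| < k.+1%:R^-1 & limiting_gradient f z w] v.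
    apply: conv_idem; apply: conv_mono conv_v => w [z xz].
    by apply: conv_mono => {}w zw; exists z.
  by exists c, a; split=> //; rewrite -vE.
have [F [FU ooF]] := ultraFilterLemma (_ : ProperFilter \oo).
have small (e : R) : 0 < e -> \forall k \near F, k.+1%:R^-1 < e.
  by move=> e0; apply: ooF; exact: (near_infty_natSinv_lt (PosNum e0)).
(* Each [a k i] is a limiting gradient at some [z] near [x], hence close to an actual gradient at a
   point [u] near [z]. *)
have near_a i (e : R) : 0 < e -> \forall k \near F, exists u,
    [/\ differentiable f u, `|x - u| < e & `|a k i - grad f u| < e].
  move=> e0; have e20 : 0 < e / 2 by rewrite divr_gt0.
  apply: filterS (small _ e20) => k ke.
  have [_ _ /(_ i)[z xz /limiting_gradientP/(_ _ e20)[u [fu zu au]]] _] := ca k.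
  exists u; split=> //; last first.
    by apply: lt_trans au _; rewrite ltr_pdivrMr// ltr_pMr// ltr1n.
  rewrite (splitr e) -(subrKA z) (le_lt_trans (ler_normD _ _))// ltrD//.
  exact: lt_trans ke.
have /choice[c' c'P] i : exists l : R, 0 <= l <= 1 /\ c k i @[k --> F] --> l.
  have [|l] := compact_ultra_cvg (u := c ^~ i) FU (@segment_compact R 0 1).
    near=> k; have [c0 c1 _ _] := ca k.
    rewrite /= in_itv /= c0 -c1 (bigD1 i)//= lerDl.
    by apply: sumr_ge0 => j _.
  by rewrite /= in_itv/=; exists l.
(* The minimum keeps [u] within the radius [r] where gradients are bounded by [C], and also bounds
   the distance from [a k i] to that gradient. *)
have /choice[a' a'P] i : exists l : 'rV[R]_n, a k i @[k --> F] --> l.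
  have [|l _] := compact_ultra_cvg (u := a ^~ i) FU
    (@rV_ball_compact R n (C + Num.min r 1)).
    have m0 : 0 < Num.min r 1 by rewrite lt_min r0 ltr01.
    apply: filterS (near_a i _ m0) => k [u [fu]] /=.
    rewrite lt_min => /andP[xu _] au.
    rewrite -(subrK (grad f u) (a k i)) addrC.
    by rewrite (le_trans (ler_normD _ _))// lerD ?gradC// ltW.
  by exists l.
have gE : \sum_i c' i *: a' i = g.
  apply: (cvg_unique (@norm_hausdorff R 'rV[R]_n)
    (F := \sum_i c k i *: a k i @[k --> F])) => /=.
    apply: cvg_big => //; first exact: add_continuous.
    by move=> i _; apply: cvgZ; [case: (c'P i)|exact: a'P].
  apply/cvgrPdist_lt => e e0; apply: filterS (small _ e0) => k.
  by have [_ _ _ /lt_trans + ke] := ca k; apply.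
have c'1 : \sum_i c' i = 1.
  apply: (cvg_unique (@norm_hausdorff R R) (F := \sum_i c k i @[k --> F])) => /=.
    apply: cvg_big => //; first exact: add_continuous.
    by move=> i _; case: (c'P i).
  under eq_fun do rewrite (let: And4 _ h _ _ := ca _ in h).
  exact: cvg_cst.
(* The limits of weights and points represent [0 <= c'] combinations equal to [g]; it remains that
   each [a' i] is a limiting gradient at [x]. *)
exists n.+1, c', a'; split=> // i; first by have [/andP[]] := c'P i.
apply/limiting_gradientP => e e0; have e20 : 0 < e / 2 by rewrite divr_gt0.
have e2e : e / 2 < e by rewrite ltr_pdivrMr// ltr_pMr// ltr1n.
have /cvgrPdist_lt/(_ _ e20) := a'P i.
move=> /(filterI (near_a i _ e20))/filter_ex[k [[u [fu xu au]] a'a]].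
exists u; split=> //; first exact: lt_trans e2e.
by rewrite (splitr e) -(subrKA (a k i)) (le_lt_trans (ler_normD _ _))// ltrD.
Unshelve. all: by end_near. Qed.

End Clarke.

(** * Where the subgradients collected by Algorithms A and B are taken *)

Section Descent.
Context (R : realType) (n : nat) (f : 'rV[R]_n -> R).
Context (beta1 beta2 zeta : R) (p : nat).
Context (zeta_itv : 0 < zeta < 2^-1).

Lemma norm_descent_dir_le1 (g : 'rV[R]_n) : `|descent_dir g| <= 1.
Proof.
have g_ge0 : 0 <= enorm g by exact: sqrtr_ge0.
rewrite normrN normrZ normfV ger0_norm//.
(* For [g = 0] the convention [0^-1 = 0] makes the direction zero. *)
have [->|g0] := eqVneq (enorm g) 0; first by rewrite invr0 mul0r.
by rewrite ler_pdivrMl ?mulr1 ?norm_le_enorm// lt_neqAle eq_sym g0.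
Qed.

Lemma ls_iter_bracket eps tbar (x g : 'rV[R]_n) t0 i t xi tl tu : 0 < tbar ->
  ls_iter f beta1 beta2 zeta p eps tbar x g t0 i t xi tl tu ->
  [/\ 0 <= tl, tl <= t, t <= tu, tu <= eps
    & clarke f (x + t *: descent_dir g) xi].
Proof.
move=> tbar0; elim=> [xi0 /andP[t0_gt t0_lt] xi0P|].
  by split=> //; rewrite ?(ltW t0_lt)//; apply/ltW; exact: lt_trans t0_gt.
move=> {}i {}t {}xi {}tl {}tu tl' tu' t' xi' _ [tl0 tlt ttu tueps _].
move=> tl'E tu'E _ _ /andP[t'l t'u] xi'P.
(* Either update replaces one endpoint by [t], which lies in the old bracket. *)
have [tl'0 tl'tu' tu'eps] : [/\ 0 <= tl', tl' <= tu' & tu' <= eps].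
  by rewrite tl'E tu'E; case: ifP => _; split=> //; lra.
have w : 0 <= zeta * (tu' - tl').
  by rewrite mulr_ge0 ?subr_ge0//; case/andP: zeta_itv => /ltW.
by split=> //; lra.
Qed.

Lemma ls_returns_subgradient_near eps tbar (x g s : 'rV[R]_n) : 0 < tbar ->
  ls_returns f beta1 beta2 zeta p eps tbar x g s false ->
  exists2 z, `|x - z| <= eps & clarke f z s.
Proof.
move=> tbar0 ret; inversion ret as [|t0 i t xi tl tu it]; subst.
have [tl0 tlt ttu tueps sP] := ls_iter_bracket tbar0 it.
exists (x + t *: descent_dir g) => //.
rewrite opprD addNKr normrN normrZ ger0_norm; last exact: le_trans tlt.
rewrite (le_trans _ (le_trans ttu tueps))// ler_piMr ?norm_descent_dir_le1//.
exact: le_trans tlt.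
Qed.

(** A serious step moves the point but restarts the working set there; a null step keeps the point
    and adds a subgradient found within [eps] of it. *)
Lemma working_set_near eps tbar delta (y0 y : 'rV[R]_n) G : 0 < tbar < eps ->
  descent_iter f beta1 beta2 zeta p eps tbar delta y0 y G ->
  G `<=` [set xi | exists2 z, `|y - z| <= eps & clarke f z xi].
Proof.
move=> /andP[tbar0 tbar_lt].
have self y' xi : clarke f y' xi ->
    [set xi] `<=` [set xi | exists2 z, `|y' - z| <= eps & clarke f z xi].
  by move=> xiP _ ->; exists y' => //; rewrite subrr normr0; lra.
elim=> [xi0||{}y {}G g s _ Gnear _ _ sP]; first exact: self.
  by move=> *; exact: self.
move=> xi [/Gnear//|->]; exact: ls_returns_subgradient_near sP.
Qed.

End Descent.

Theorem theorem5p1 (R : realType) (n : nat) (f : 'rV[R]_n -> R)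
    (x0 : 'rV[R]_n) (beta1 beta2 zeta : R) (p : nat)
    (delta eps tbar : nat -> R) (x : nat -> 'rV[R]_n) (xstar : 'rV[R]_n)
    (f_lip : locally_lipschitz f)
    (f_wus : weakly_upper_semismooth f)
    (sublevel_bounded : bounded_set [set y | f y <= f x0])
    (beta1_gt0 : 0 < beta1) (beta12 : beta1 < beta2) (beta2_lt1 : beta2 < 1)
    (zeta_itv : 0 < zeta < 2^-1) (p_gt0 : (0 < p)%N)
    (delta_to0 : decreases_to0 delta)
    (eps_to0 : decreases_to0 eps) (eps_lt1 : forall nu, eps nu < 1)
    (tbar_itv : forall nu, 0 < tbar nu < eps nu)
    (x_run : outer_run f beta1 beta2 zeta p eps tbar delta 0 x0 x)
    (xstar_acc : cluster (x nu @[nu --> \oo]) xstar) :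
  clarke f xstar 0.
Proof.
have [delta_gt0 _ delta_cvg] := delta_to0; have [eps_gt0 _ eps_cvg] := eps_to0.
(* Half of [r] is for the distance from [xstar] to the iterate, half for [eps nu]. *)
apply: clarke_closed => // r r0; have r20 : 0 < r / 2 by rewrite divr_gt0.
have small : \forall nu \near \oo, delta nu < r /\ eps nu < r / 2.
  by apply: filterI; [exact: cvgr_lt delta_cvg _ _|exact: cvgr_lt eps_cvg _ _].
(* The call with [delta nu] and [eps nu] returns [x nu.+1], so the cluster point is tested against
   shifted iterates. *)
pose A := [set y | exists2 nu, delta nu < r /\ eps nu < r / 2 & y = x nu.+1].
have xA : (x nu @[nu --> \oo]) A.
  by apply: near_inftyS; apply: filterS small => nu /= nuP; exists nu.
have [_ [[nu [deltar epsr] ->]]] := xstar_acc _ _ xA (nbhsx_ballx xstar _ r20).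
rewrite -ball_normE /=; have [_ /(_ nu)] := x_run; move: (x nu.+1) => _ [].
  (* With tolerance 0 and positive [delta], no earlier index stops the run. *)
  by move=> mu _; rewrite leNgt delta_gt0.
move=> y G g /(working_set_near zeta_itv (tbar_itv nu)) Gnear [Gg _] gd xstary.
exists g; last first.
  by rewrite sub0r normrN (le_lt_trans (norm_le_enorm g))// (le_lt_trans gd).
apply: conv_mono Gg => w /Gnear[z yz zw]; exists z => //.
rewrite (splitr r) -(subrKA y) (le_lt_trans (ler_normD _ _))// ltrD//.
exact: le_lt_trans epsr.
Qed.
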